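(* Let $\alpha$ be an ordinal. Then $\mathscr{SZ}_\alpha$ has the $\mathscr{SZ}_{\alpha+1}$-factorization property. That is, for all Banach spaces $E,F$ and every operator $T:E\to F$ with $\mathrm{Sz}(T)\leqslant\omega^\alpha$, there exist a Banach space $G$ with $\mathrm{Sz}(G)\leqslant\omega^{\alpha+1}$ and operators $A:E\to G$ and $B:G\to F$ such that $T=BA$.
   Context: Banach spaces are over $\mathbb K\in\{\mathbb R,\mathbb C\}$; an operator is a bounded linear map between Banach spaces; $B_E$ is the closed unit ball of $E$; $T^*$ is the adjoint of $T$. Szlenk index. Let $E$ be a Banach space, $K\subseteq E^*$ a $w^*$-compact set and $\varepsilon>0$. Put $s_\varepsilon(K)=\{x\in K : \operatorname{diam}(K\cap V)>\varepsilon \text{ for every } w^*\text{-open } V\ni x\}$ (norm diameter), $s^0_\varepsilon(K)=K$, $s^{\alpha+1}_\varepsilon(K)=s_\varepsilon(s^\alpha_\varepsilon(K))$, and $s^\alpha_\varepsilon(K)=\bigcap_{\beta<\alpha}s^\beta_\varepsilon(K)$ for limit ordinals $\alpha$. $\mathrm{Sz}_\varepsilon(K)$ is the class of all ordinals $\alpha$ with $s^\alpha_\varepsilon(K)\neq\emptyset$; that is, the least ordinal $\alpha$ with $s^\alpha_\varepsilon(K)=\emptyset$ if one exists, and otherwise the class of all ordinals, written $\infty$. $\mathrm{Sz}(K)=\bigcup_{\varepsilon>0}\mathrm{Sz}_\varepsilon(K)=\sup_{\varepsilon>0}\mathrm{Sz}_\varepsilon(K)$. For a Banach space $E$, $\mathrm{Sz}(E)=\mathrm{Sz}(B_{E^*})$;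 for an operator $T:E\to F$, $\mathrm{Sz}(T)=\mathrm{Sz}(T^*B_{F^*})$. $\mathscr{SZ}_\alpha$ is the class of all operators $T$ with $\mathrm{Sz}(T)\leqslant\omega^\alpha$. For operator ideals $\mathscr I,\mathscr J$, $\mathscr I$ has the $\mathscr J$-factorization property if every element of $\mathscr I$ factors (with bounded linear factors) through a Banach space whose identity operator belongs to $\mathscr J$. *)

(* Defs.v *)
From HB Require Import structures.
From mathcomp Require Import all_boot all_order all_algebra.
From mathcomp Require Import complex.
From mathcomp Require Import all_classical all_reals all_analysis.

Set Implicit Arguments.
Unset Strict Implicit.
Unset Printing Implicit Defensive.
Import Order.TTheory GRing.Theory Num.Theory.
Import numFieldNormedType.Exports.
Local Open Scope classical_set_scope.
Local Open Scope ring_scope.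

(* Ordinals are represented by well-founded trees with arbitrarily branching
   suprema: [osup f] denotes the supremum of the ordinals [f i] (in particular
   [0] when [I] is empty), whether or not it is a limit.  Every ordinal is
   denoted by some tree, and several trees denote the same ordinal: equality of
   ordinals is [ole a b /\ ole b a], not Leibniz equality. *)
Inductive ord : Type :=
| ozero
| osucc of ord
| osup (I : Type) of (I -> ord).

(* [succ_le P b] is [a < b] when [P] is the predicate [a <= _]. *)
Fixpoint succ_le (P : ord -> Prop) (b : ord) : Prop :=
  match b with
  | ozero => False
  | osucc b' => P b'
  | osup _ g => exists i, succ_le P (g i)
  end.

Fixpoint ole (a : ord) : ord -> Prop :=
  match a with
  | ozero => fun=> True
  | osucc a' => succ_le (ole a')
  | osup _ f => fun b => forall i, ole (f i) b
  end.

Definition olt (a b : ord) : Prop := ole (osucc a) b.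

(* Supremum of [a] and all the [f i]; unlike [osup f], it is correct for
   formulas whose value at an empty supremum is [a]. *)
Definition osup_from (a : ord) (I : Type) (f : I -> ord) : ord :=
  osup (fun o : option I => if o is Some i then f i else a).

Fixpoint oadd (a b : ord) : ord :=
  match b with
  | ozero => a
  | osucc b' => osucc (oadd a b')
  | osup _ g => osup_from a (fun i => oadd a (g i))
  end.

Fixpoint omul (a b : ord) : ord :=
  match b with
  | ozero => ozero
  | osucc b' => oadd (omul a b') a
  | osup _ g => osup (fun i => omul a (g i))
  end.

Definition omega : ord := osup (fun n : nat => iter n osucc ozero).

Fixpoint omega_pow (a : ord) : ord :=
  match a with
  | ozero => osucc ozero
  | osucc a' => omul (omega_pow a') omega
  | osup _ f => osup_from (osucc ozero) (fun i => omega_pow (f i))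
  end.

Definition is_limit (a : ord) : Prop :=
  olt ozero a /\ forall b, olt b a -> olt (osucc b) a.

(* A class of ordinals compared with an ordinal, the latter being identified
   with the set of its predecessors. *)
Definition class_le (C : ord -> Prop) (a : ord) : Prop :=
  forall b, C b -> olt b a.

Section ord_theory.
Implicit Types a b c : ord.

Lemma succ_le_sub (P Q : ord -> Prop) b :
  (forall c, P c -> Q c) -> succ_le P b -> succ_le Q b.
Proof.
move=> PQ; elim: b => [|b _|I g IH] //=; first exact: PQ.
by case=> i /IH Qi; exists i.
Qed.

Lemma ole_sup a I (g : I -> ord) i : ole a (g i) -> ole a (osup g).
Proof.
elim: a => [|a _|J f IH] //= ai; last by move=> j; exact/IH/ai.
by exists i.
Qed.

Lemma ole_refl a : ole a a.
Proof.
elim: a => [|a IH|I f IH] //= i; exact: ole_sup (IH i).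
Qed.

Lemma ole_trans a b c : ole a b -> ole b c -> ole a c.
Proof.
elim: a b c => [|a IHa|I f IH] //= b c; last by move=> ab bc i; exact: IH (ab i) bc.
elim: b c => [|b _|J g IHb] //= c.
  by move=> ab; apply: succ_le_sub => d; exact: IHa.
by move=> [j aj] /(_ j); exact: IHb.
Qed.

Lemma ole_succ a : ole a (osucc a).
Proof.
elim: a => [|a IH|I f IH] //= i.
apply: ole_trans (IH i) _ => /=; exact: ole_sup (ole_refl _).
Qed.

Lemma olt_le a b : olt a b -> ole a b.
Proof. exact: ole_trans (ole_succ a). Qed.

Lemma ole_lt_total a b : ole a b \/ olt b a.
Proof.
elim: a b => [|a IHa|I f IH] b; first by left.
- elim: b => [|b _|J g IHb]; first by right.
    by case: (IHa b); [left|right].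
  have [[j aj]|/forallNP na] := pselect (exists j, ole (osucc a) (g j)).
    by left; exists j.
  by right=> j; case: (IHb j) => // /na.
- have [ab|/existsNP[i nab]] := pselect (forall i, ole (f i) b); first by left.
  by right; exists i; case: (IH i b).
Qed.

Lemma olt_wf : well_founded olt.
Proof.
suff H a : forall b, ole b a -> Acc olt b by move=> a; exact: H (ole_refl a).
elim: a => [|a IH|I f IH] b ba; constructor=> c cb.
- by have := ole_trans cb ba.
- by apply: IH; have := ole_trans cb ba.
- have [i ci] : exists i, olt c (f i) by have := ole_trans cb ba.
  exact: (IH i c (olt_le ci)).
Qed.

Lemma oadd_mono a a' b b' : ole a a' -> ole b b' -> ole (oadd a b) (oadd a' b').
Proof.
have base c d : ole c (oadd c d).
  elim: d => [|d IH|I g IH] /=; first exact: ole_refl.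
    exact: ole_trans IH (ole_succ _).
  by apply: (@ole_sup _ (option I) _ None); exact: ole_refl.
move=> aa'; elim: b b' => [|b IH|I f IH] b' /=.
- by move=> _; exact: ole_trans aa' (base _ _).
- elim: b' => [|b' _|J g IHg] //=; first exact: IH.
  by case=> j /IHg H; exists (Some j).
- move=> bb' [i|]; last exact: ole_trans aa' (base _ _).
  exact/IH/bb'.
Qed.

Lemma omul_mono a a' b b' : ole a a' -> ole b b' -> ole (omul a b) (omul a' b').
Proof.
move=> aa'; elim: b b' => [|b IH|I f IH] b' //=; last by move=> bb' i; exact/IH/bb'.
elim: b' => [|b' _|J g IHg] //=; first by move=> /IH /oadd_mono; exact.
by case=> j /IHg; exact: ole_sup.
Qed.

Lemma omega_pow_mono a b : ole a b -> ole (omega_pow a) (omega_pow b).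
Proof.
have le_add c d : ole c (oadd d c).
  elim: c => [|c IH|I g IH] //= i.
  exact: (@ole_sup _ (option I) _ (Some i)) (IH i).
have base c : ole (osucc ozero) (omega_pow c).
  elim: c => [|c IH|I f _] //; last by exists None.
  by exists 1; apply: ole_trans IH _; exact: le_add.
elim: a b => [|a IH|I f IH] b; first by move=> _; exact: base.
- elim: b => [|b _|J g IHg] //.
    by move=> ab; exact: omul_mono (IH b ab) (ole_refl _).
  by case=> j /IHg; exact: (@ole_sup _ (option J) _ (Some j)).
- by move=> ab [i|] /=; [exact/IH/ab|exact: base].
Qed.

End ord_theory.

Section operators.
Context {K : numFieldType}.

Record operator (E F : normedModType K) := Operator {
  op_fun :> E -> F ;
  op_linear : linear op_fun ;
  op_bounded : bounded_near op_fun (nbhs (0 : E)) }.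

HB.instance Definition _ E F (T : operator E F) :=
  GRing.isLinear.Build K E F _ (op_fun T) (op_linear T).

HB.instance Definition _ E F := gen_eqMixin (operator E F).
HB.instance Definition _ E F := gen_choiceMixin (operator E F).

Lemma operator_ext E F (S T : operator E F) : (forall x, S x = T x) -> S = T.
Proof.
case: S T => [f fl fb] [g gl gb] /= fg.
have {}fg : f = g by exact/funext.
by subst g; congr Operator; exact: Prop_irrelevance.
Qed.

Lemma op_continuous E F (T : operator E F) : continuous T.
Proof. exact: bounded_linear_continuous (op_bounded T). Qed.

Lemma id_op_bounded (E : normedModType K) :
  bounded_near (idfun : E -> E) (nbhs (0 : E)).
Proof. by apply: continuous_linear_bounded => x; exact. Qed.

Definition id_op (E : normedModType K) : operator E E :=
  Operator (fun _ _ _ => erefl) (@id_op_bounded E).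

Lemma comp_op_linear (E F G : normedModType K)
  (S : operator F G) (T : operator E F) : linear (S \o T).
Proof. by move=> a x y /=; rewrite !linearP. Qed.

Lemma comp_op_bounded (E F G : normedModType K)
  (S : operator F G) (T : operator E F) :
  bounded_near (S \o T) (nbhs (0 : E)).
Proof.
apply: continuous_linear_bounded.
by apply: continuous_comp; exact: op_continuous.
Qed.

Definition comp_op (E F G : normedModType K)
    (S : operator F G) (T : operator E F) : operator E G :=
  Operator (@comp_op_linear E F G S T) (@comp_op_bounded E F G S T).

Definition dual (E : normedModType K) := operator E (K^o : normedModType K).

Definition adjoint (E F : normedModType K) (T : operator E F) :
  dual F -> dual E := fun g => comp_op g T.

Definition wstar_open (E : normedModType K) : set (set (dual E)) :=
  @open (initial_topology (fun f : dual E => (op_fun f : {ptws E -> K^o}))).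

Definition op_class :=
  forall E F : completeNormedModType K, operator E F -> Prop.

Definition has_factorization_property (I J : op_class) : Prop :=
  forall (E F : completeNormedModType K) (T : operator E F), I E F T ->
  exists G : completeNormedModType K, J G G (id_op G) /\
  exists (A : operator E G) (B : operator G F), T = comp_op B A.

End operators.
Arguments op_class K : clear implicits.

Inductive scalar_kind := RealScalars | ComplexScalars.

Definition scalars (R : realType) (k : scalar_kind) : numFieldType :=
  match k with RealScalars => R | ComplexScalars => R[i] end.

(* Norms of spaces over [K] are values of [K] itself; this recovers the real
   number. *)
Definition real_part (R : realType) (k : scalar_kind) : scalars R k -> R :=
  match k with RealScalars => id | ComplexScalars => @complex.Re R end.

Section szlenk.
Context {R : realType} {k : scalar_kind}.
Local Notation K := (scalars R k).

Definition dual_norm (E : normedModType K) (f : E -> K^o) : \bar R :=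
  ereal_sup [set (real_part `|f x|)%:E | x in [set x : E | `|x| <= 1]].

Definition dual_ball (E : normedModType K) : set (dual E) :=
  [set f | (dual_norm f <= 1)%E].

Definition diam (E : normedModType K) (A : set (dual E)) : \bar R :=
  ereal_sup [set dual_norm (f \- g) | f in A & g in A].

Definition szlenk_derivative (E : normedModType K) (eps : R)
    (A : set (dual E)) : set (dual E) :=
  [set f | A f /\ forall V : set (dual E), wstar_open V -> V f ->
                    (eps%:E < diam (A `&` V))%E].

(* The derivations decrease, so at a supremum the iterate is the intersection
   over any family having that supremum; the conjunct [A f] only matters for the
   empty family, whose supremum is [0].  The usual clause at limit ordinals is
   [szlenk_iter_limit] below. *)
Fixpoint szlenk_iter (E : normedModType K) (eps : R) (A : set (dual E))
    (a : ord) : set (dual E) :=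
  match a with
  | ozero => A
  | osucc b => szlenk_derivative eps (szlenk_iter eps A b)
  | osup _ b_ => [set f | A f /\ forall i, szlenk_iter eps A (b_ i) f]
  end.

Definition Sz_eps (E : normedModType K) (eps : R) (A : set (dual E)) :
  ord -> Prop := fun a => szlenk_iter eps A a !=set0.

Definition Sz (E : normedModType K) (A : set (dual E)) : ord -> Prop :=
  fun a => exists2 eps : R, 0 < eps & Sz_eps eps A a.

Definition Sz_space (E : normedModType K) : ord -> Prop := Sz (@dual_ball E).

Definition Sz_op (E F : normedModType K) (T : operator E F) : ord -> Prop :=
  Sz (adjoint T @` @dual_ball F).

Definition SZ (a : ord) : op_class K :=
  fun E F T => class_le (Sz_op T) (omega_pow a).

Lemma diam_sub (E : normedModType K) (A B : set (dual E)) :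
  A `<=` B -> (diam A <= diam B)%E.
Proof.
move=> AB; apply: le_ereal_sup => _ [f Af] [g Ag] <-.
by exists f; [exact: AB|exists g => //; exact: AB].
Qed.

Lemma szlenk_iter_sub (E : normedModType K) eps (A : set (dual E)) a :
  szlenk_iter eps A a `<=` A.
Proof. by elim: a => [|a IH|I f IH] g //= [] // /IH. Qed.

Lemma szlenk_iter_anti (E : normedModType K) eps (A : set (dual E)) a b :
  ole a b -> szlenk_iter eps A b `<=` szlenk_iter eps A a.
Proof.
elim: a b => [|a IH|I f IH] b; first by move=> _; exact: szlenk_iter_sub.
- elim: b => [|b _|J g IHg] //=.
    move=> ab h [bh dh]; split; first exact: IH ab _ bh.
    move=> V oV Vh; apply: lt_le_trans (dh V oV Vh) _.
    by apply: diam_sub; apply: setSI; exact: IH.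
  by case=> j /IHg H h [_ /(_ j)]; exact: H.
- move=> ab g bg; split; first exact: szlenk_iter_sub bg.
  by move=> i; exact: IH (ab i) _ bg.
Qed.

Lemma szlenk_iter_limit (E : normedModType K) eps (A : set (dual E)) a :
  is_limit a ->
  szlenk_iter eps A a = [set f | forall b, olt b a -> szlenk_iter eps A b f].
Proof.
case=> a0 aS; apply/seteqP; split=> f.
  by move=> af b ba; exact: szlenk_iter_anti (olt_le ba) _ af.
move=> /= H; suff: forall c, ole c a -> szlenk_iter eps A c f.
  by apply; exact: ole_refl.
elim=> [|c _|I g IH] /= ca; first exact: (H ozero).
  exact: (H (osucc c) (aS c ca)).
by split=> [|i]; [exact: (H ozero)|exact: IH (ca i)].
Qed.

End szlenk.

(* Main.v *)
Require Import Defs.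
From HB Require Import structures.
From mathcomp Require Import all_boot all_order all_algebra.
From mathcomp Require Import complex.
From mathcomp Require Import all_classical all_reals all_analysis.
From mathcomp Require Import ring lra.

Set Implicit Arguments.
Unset Strict Implicit.
Unset Printing Implicit Defensive.
Import Order.TTheory GRing.Theory Num.Theory.
Import numFieldNormedType.Exports.
Local Open Scope classical_set_scope.
Local Open Scope ring_scope.

(* Equip F with the seminorms p_n(y) = inf_x (2^-n |x| + 2^n |y - T x|) and let
   G be the space of those y in F with p_n(y) -> 0, normed by sup_n p_n(y).  It
   contains the range of T, since p_n(T x) <= 2^-n |x|; A is T with values in G
   and B is the inclusion.  As |f| <= (2^n |T^* f| + 2^-n |f|_F) p_n on F, small
   values of |f o T| force small values of |B^* f| uniformly on the unit ball of
   F^*.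

   Let |y|_G <= 1 and p_n(y) <= 1/4 for n >= N.  The norm of G is the maximum of
   the first N seminorms and of the remaining ones, so by Hahn-Banach any h in
   r B_{G^*} splits as h = f o B + h' with |f| + |h'| <= r for the dual
   seminorms; if moreover |h(y)| > r - d, then |h'| < 4d/3.  Hence the slice
   {|h(y)| > r - d} of r B_{G^*} lies within 2d of a multiple of B^* B_{F^*}, and
   weak* compactness of B_{F^*} transfers Sz(T) <= omega^a to this slice.  So
   each omega^a derivations of B_{G^*} with parameter eps decrease the radius by
   eps/16, and omega^a n derivations exhaust the ball for some finite n. *)

(** * Real and complex scalars *)

Section scalars.
Context {R : realType} {k : scalar_kind}.
Local Notation K := (scalars R k).

Definition of_real : R -> K :=
  match k return R -> scalars R k with
  | RealScalars => id
  | ComplexScalars => fun a => (a%:C)%C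
  end.

(** Norms take values in [K]; their real versions allow linear arithmetic over [R] in both scalar
    cases at once. *)
Definition rnorm (V : normedZmodType K) (x : V) : R := real_part `|x|.

Lemma real_partD (x y : K) : real_part (x + y) = real_part x + real_part y.
Proof. by rewrite /real_part; case: k x y => //= -[a b] [c d]. Qed.

Lemma real_partN (x : K) : real_part (- x) = - real_part x.
Proof. by rewrite /real_part; case: k x => //= -[a b]. Qed.

Lemma real_part_mul (a : R) (x : K) : real_part (of_real a * x) = a * real_part x.
Proof.
by rewrite /real_part /of_real; case: k x => //= -[c d] /=; rewrite mul0r subr0.
Qed.

Lemma of_realK : cancel of_real (@real_part R k).
Proof. by rewrite /real_part /of_real; case: k. Qed.

Lemma of_realM (a b : R) : of_real (a * b) = of_real a * of_real b.
Proof. by rewrite /of_real; case: k => //=; rewrite rmorphM. Qed.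

Lemma of_realD (a b : R) : of_real (a + b) = of_real a + of_real b.
Proof. by rewrite /of_real; case: k => //=; rewrite rmorphD. Qed.

Lemma of_realN (a : R) : of_real (- a) = - of_real a.
Proof. by rewrite /of_real; case: k => //=; rewrite rmorphN. Qed.

Lemma of_real0 : of_real 0 = 0.
Proof. by rewrite /of_real; case: k. Qed.

Lemma of_real1 : of_real 1 = 1.
Proof. by rewrite /of_real; case: k. Qed.

Lemma ler_of_real (a b : R) : (of_real a <= of_real b) = (a <= b).
Proof. by rewrite /of_real; case: k => //=; rewrite lecR. Qed.

Lemma ltr_of_real (a b : R) : (of_real a < of_real b) = (a < b).
Proof. by rewrite /of_real; case: k => //=; rewrite ltcR. Qed.

Lemma ge0_of_real (x : K) : 0 <= x -> x = of_real (real_part x).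
Proof.
rewrite /of_real /real_part; case: k x => //= -[a b].
by rewrite lecE /= => /andP[/eqP -> _].
Qed.

Lemma norm_of_real (a : R) : `|of_real a| = of_real `|a|.
Proof. by rewrite /of_real; case: k => //=; rewrite normc_def /= expr0n addr0 sqrtr_sqr. Qed.

Lemma real_part_le_norm (x : K) : real_part x <= real_part `|x|.
Proof.
rewrite /real_part; case: k x => /= [x|[a b]]; first exact: ler_norm.
apply: le_trans (ler_norm _) _.
by rewrite /= -sqrtr_sqr ler_sqrt ?lerDl ?addr_ge0 ?sqr_ge0.
Qed.

Lemma rotate_to_norm (x : K) :
  exists c : K, `|c| = 1 /\ c * x = of_real (real_part `|x|).
Proof.
have [->|x0] := eqVneq x 0.
  by exists 1; rewrite normr1 mulr0 normr0 -ge0_of_real.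
exists (`|x| / x); rewrite -ge0_of_real //; split; last by rewrite mulfVK.
by rewrite normrM normfV normr_id divff // normr_eq0.
Qed.

(** Over the complex numbers the functional is recovered from its real part by g(x) = f(x) - i f(i
    x). *)
Lemma complexify (V : lmodType K) (f : V -> R) :
  (forall x y, f (x + y) = f x + f y) ->
  (forall a x, f (of_real a *: x) = a * f x) ->
  exists g : {linear V -> K^o}, forall x, real_part (g x) = f x.
Proof.
move=> fD fZ; suff [g lg gf] : exists2 g : V -> K^o, linear g &
    forall x, real_part (g x) = f x.
  pose g' : {linear V -> K^o} := HB.pack g (GRing.isLinear.Build _ _ _ _ g lg).
  by exists g'.
move: V f fD fZ; rewrite /of_real /real_part; case: k => /= V f fD fZ.
  by exists f => // a x y; rewrite fD fZ.
pose g x : R[i]^o := (f x +i* - f ('i%C *: x))%C.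
exists g => // -[a b] x y.
have E z : (a +i* b)%C *: z = (a%:C)%C *: z + (b%:C)%C *: ('i%C *: z).
  rewrite scalerA -scalerDl; congr (_ *: _).
  by apply/eqP; rewrite eq_complex /= ; apply/andP; split; apply/eqP; lra.
have I : 'i%C *: ('i%C *: x) = (-1)%:C%C *: x.
  rewrite scalerA; congr (_ *: _).
  by apply/eqP; rewrite eq_complex /= ; apply/andP; split; apply/eqP; lra.
have fi : f ('i%C *: ((a +i* b)%C *: x)) = a * f ('i%C *: x) - b * f x.
  rewrite scalerA mulrC -scalerA E I fD (fZ a) (fZ b) (fZ (-1)).
  lra.
apply/eqP; rewrite /g eq_complex /=; apply/andP; split; apply/eqP.
  by rewrite fD E fD (fZ a) (fZ b); lra.
by rewrite scalerDr fD fi; lra.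
Qed.

(** Containment in a compact set is enough for limits along ultrafilters, and it lets a square stand
    in for the complex disc. *)
Lemma closed_ball_subset_compact (r : R) :
  exists2 C : set K^o, compact C & [set z : K^o | rnorm z <= r] `<=` C.
Proof.
rewrite /rnorm; case: k => /=.
  exists `[- r, r]%classic; first exact: segment_compact.
  by move=> z /=; rewrite in_itv /= ler_norml.
pose c (z : R * R) : R[i]^o := (z.1 +i* z.2)%C.
exists (c @` (`[- r, r] `*` `[- r, r])%classic).
  apply: continuous_compact; last by apply: compact_setX; exact: segment_compact.
  apply: continuous_subspaceT => z; apply/cvgrPdist_lt => -[e e']; rewrite ltcE /= => /andP[/eqP -> e0].
  near=> w; rewrite ltcR.
  have w1 : `|z.1 - w.1| < e / 2.
    near: w; apply: (@cvgr_dist_lt _ _ _ _ _ fst z.1 cvg_fst).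
    by rewrite divr_gt0.
  have w2 : `|z.2 - w.2| < e / 2.
    near: w; apply: (@cvgr_dist_lt _ _ _ _ _ snd z.2 cvg_snd).
    by rewrite divr_gt0.
  rewrite -(gtr0_norm e0) -sqrtr_sqr ltr_sqrt ?exprn_gt0 //.
  rewrite -(real_normK (num_real (z.1 - w.1))) -(real_normK (num_real (z.2 - w.2))).
  have := normr_ge0 (z.1 - w.1); have := normr_ge0 (z.2 - w.2); nra.
move=> [a b] /= ab.
exists (a, b) => //; split; rewrite /= in_itv /= -ler_norml; apply: le_trans ab;
  by rewrite -sqrtr_sqr ler_sqrt ?lerDl ?lerDr ?addr_ge0 ?sqr_ge0.
Unshelve. all: by end_near. Qed.

End scalars.

Section rnorm_theory.
Context {R : realType} {k : scalar_kind}.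
Local Notation K := (scalars R k).

Lemma normE (V : normedZmodType K) (x : V) : `|x| = of_real (rnorm x).
Proof. exact: ge0_of_real. Qed.

Lemma rnorm_ge0 (V : normedZmodType K) (x : V) : 0 <= rnorm x.
Proof. by rewrite -(@ler_of_real R k) of_real0 -normE. Qed.

Lemma rnormD (V : normedZmodType K) (x y : V) : rnorm (x + y) <= rnorm x + rnorm y.
Proof. by rewrite -(@ler_of_real R k) of_realD -!normE ler_normD. Qed.

Lemma rnormN (V : normedZmodType K) (x : V) : rnorm (- x) = rnorm x.
Proof. by rewrite /rnorm normrN. Qed.

Lemma rnorm0 (V : normedZmodType K) : rnorm (0 : V) = 0.
Proof. by rewrite /rnorm normr0 -of_real0 of_realK. Qed.

Lemma rnorm0_eq0 (V : normedZmodType K) (x : V) : rnorm x = 0 -> x = 0.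
Proof. by move=> x0; apply/normr0_eq0; rewrite normE x0 of_real0. Qed.

Lemma rdistC (V : normedZmodType K) (x y : V) : rnorm (x - y) = rnorm (y - x).
Proof. by rewrite -rnormN opprB. Qed.

Lemma rdistD (V : normedZmodType K) (x y z : V) :
  rnorm (x - z) <= rnorm (x - y) + rnorm (y - z).
Proof. by apply: le_trans (rnormD _ _); rewrite addrA subrK. Qed.

Lemma rnormZ (V : normedModType K) (a : K) (x : V) :
  rnorm (a *: x) = rnorm a * rnorm x.
Proof. by rewrite {1}/rnorm normrZ (normE a) (real_part_mul). Qed.

Lemma rnormM (a b : K) : rnorm (a * b) = rnorm a * rnorm b.
Proof. by rewrite {1}/rnorm normrM (normE a) real_part_mul. Qed.

Lemma functionalZ (V : lmodType K) (g : {linear V -> K^o}) (a : K) (x : V) :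
  g (a *: x) = a * g x.
Proof. by rewrite linearZ. Qed.

Lemma rnorm_of_real (a : R) : rnorm (of_real a : K) = `|a|.
Proof. by rewrite /rnorm norm_of_real of_realK. Qed.

Lemma rnorm1 : rnorm (1 : K) = 1.
Proof. by rewrite -of_real1 rnorm_of_real normr1. Qed.

Lemma rotate_to_rnorm (x : K) :
  exists2 c : K, rnorm c = 1 & real_part (c * x) = rnorm x.
Proof.
have [c [c1 cx]] := rotate_to_norm x; exists c; last by rewrite cx of_realK.
by rewrite /rnorm c1 -of_real1 of_realK.
Qed.

End rnorm_theory.

(** * Hahn-Banach *)

Section hahn_banach.
Context {R : realType} {k : scalar_kind}.
Local Notation K := (scalars R k).
Variable V : lmodType K.
Implicit Types (p q : V -> R) (x y : V).

Definition sublinear p :=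
  (forall x y, p (x + y) <= p x + p y) /\
  (forall (a : R) x, 0 <= a -> p (of_real a *: x) = a * p x).

Lemma sublinear0 p : sublinear p -> p 0 = 0.
Proof. by move=> [_ /(_ 0 0 (lexx _))]; rewrite scaler0 mul0r. Qed.

Lemma sublinear_ge p x : sublinear p -> - p (- x) <= p x.
Proof.
move=> sp; have := sp.1 x (- x); rewrite subrr sublinear0 // => h; lra.
Qed.

(** Near-minimizers can be added and scaled. The lemma serves the lower bounds of chains, the
    Hahn-Banach step, the interpolation seminorms and the splitting of functionals. *)
Lemma sublinear_inf (S : V -> set R) :
  (forall x, S x !=set0) -> (forall x, has_lbound (S x)) ->
  (forall x y a b, S x a -> S y b -> exists2 c, S (x + y) c & c <= a + b) ->
  (forall t x a, 0 <= t -> S x a -> exists2 c, S (of_real t *: x) c & c <= t * a) ->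
  sublinear (fun x => inf (S x)).
Proof.
move=> S0 Sb SD SZ.
have hS x : has_inf (S x) by [].
have Z t x : 0 <= t -> inf (S (of_real t *: x)) <= t * inf (S x).
  move=> t0; apply/ler_addgt0Pr => e e0.
  (* The denominator t + 1 also covers t = 0. *)
  have e't : 0 < e / (t + 1) by rewrite divr_gt0 // ltr_wpDl.
  have [a Sa ai] := inf_adherent e't (hS x).
  have [c Sc ca] := SZ _ _ _ t0 Sa.
  apply: le_trans (ge_inf (Sb _) Sc) _; apply: le_trans ca _.
  apply: le_trans (ler_wpM2l t0 (ltW ai)) _.
  rewrite mulrDr lerD2l mulrC mulrAC ler_pdivrMr ?ltr_wpDl //.
  by rewrite mulrDr mulr1 lerDl ltW.
split=> [x y|t x].
- apply/ler_addgt0Pr => e e0.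
  have e2 : 0 < e / 2 by rewrite divr_gt0.
  have [a Sa ai] := inf_adherent e2 (hS x).
  have [b Sb' bi] := inf_adherent e2 (hS y).
  have [c Sc cab] := SD _ _ _ _ Sa Sb'.
  apply: le_trans (ge_inf (Sb _) Sc) _; lra.
- rewrite le_eqVlt => /predU1P[<-|t0].
    (* At t = 0 the infimum m of [S 0] has to vanish: scaling by 0 gives m <= 0, and scaling by 2
       gives m <= 2 m. *)
    rewrite mul0r of_real0 scale0r; apply/eqP; rewrite eq_le; apply/andP; split.
      by have := Z 0 0 (lexx _); rewrite scaler0 mul0r.
    have := Z 2 0 (ler0n _ _); rewrite scaler0 => ?; lra.
  apply/eqP; rewrite eq_le; apply/andP; split; first exact: Z (ltW t0).
  have := Z t^-1 (of_real t *: x); rewrite invr_ge0 ltW // => /(_ isT).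
  rewrite scalerA -of_realM mulVf ?gt_eqF // of_real1 scale1r.
  by rewrite ler_pdivlMl.
Qed.

(** Zorn's lemma for the reversed order: a chain is bounded by its pointwise infimum, which is
    finite because every member is at least -p(-x). *)
Lemma minimal_sublinear p : sublinear p ->
  exists q, [/\ sublinear q, forall x, q x <= p x &
    forall q', sublinear q' -> (forall x, q' x <= q x) -> q' = q].
Proof.
move=> sp.
pose T := {q : V -> R | sublinear q /\ forall x, q x <= p x}.
pose L (q q' : T) := `[< forall x, sval q' x <= sval q x >].
have [|||A totA|[q [sq qp]] qmin] := @Zorn T L.
- by move=> t; apply/asboolP.
- move=> r s t /asboolP rs /asboolP st; apply/asboolP => x.
  exact: le_trans (st x) (rs x).
- move=> [s ps] [t pt] /asboolP /= st /asboolP /= ts; apply/eq_exist/funext => x.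
  by apply/eqP; rewrite eq_le st ts.
- have [[q0 Aq0]|A0] := pselect (exists t, A t); last first.
    exists (exist _ p (conj sp (fun x => lexx _))) => s As.
    by case: A0; exists s.
  pose S x := [set sval q x | q in A].
  have Sb x : has_lbound (S x).
    exists (- p (- x)) => _ [q Aq <-]; case: q Aq => /= q [sq qp] _.
    by apply: le_trans (sublinear_ge x sq); rewrite lerN2.
  have sS : sublinear (fun x => inf (S x)).
    apply: sublinear_inf => // [x|x y _ _ [q Aq <-] [q' Aq' <-]|t x _ t0 [q Aq <-]].
    - by exists (sval q0 x); exists q0.
    - have [/asboolP h|/asboolP h] := totA _ _ Aq Aq'.
        exists (sval q' (x + y)); first by exists q'.
        by apply: le_trans ((svalP q').1.1 _ _) _; rewrite lerD2r.
      exists (sval q (x + y)); first by exists q.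
      by apply: le_trans ((svalP q).1.1 _ _) _; rewrite lerD2l.
    - exists (sval q (of_real t *: x)); first by exists q.
      by rewrite (svalP q).1.2.
  have Sp x : inf (S x) <= p x.
    by apply: le_trans (ge_inf (Sb x) _) ((svalP q0).2 x); exists q0.
  exists (exist (fun q => sublinear q /\ forall x, q x <= p x) _ (conj sS Sp)) => s As; apply/asboolP => x /=.
  by apply: ge_inf => //; exists s.
exists q; split=> // q' sq' q'q.
have q'p x : q' x <= p x := le_trans (q'q x) (qp x).
have /(congr1 sval) := qmin (exist _ q' (conj sq' q'p)) (asboolT q'q).
by [].
Qed.

(* Along a direction y, the sublinear functional
   x |-> inf_(t >= 0) (q (x + t y) - t q y) lies below q; if q is minimal the
   two coincide, which forces q to be additive. *)
Lemma hahn_banach p : sublinear p ->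
  exists f : V -> R, [/\ forall x y, f (x + y) = f x + f y,
    forall a x, f (of_real a *: x) = a * f x & forall x, f x <= p x].
Proof.
move=> /minimal_sublinear[q [sq qp qmin]].
have supadd y x : q x + q y <= q (x + y).
  pose S x := [set q (x + of_real t *: y) - t * q y | t in [set t | 0 <= t]].
  have Sb z : has_lbound (S z).
    exists (- q (- z)) => _ [t /= t0 <-].
    have := sq.1 (z + of_real t *: y) (- z).
    rewrite addrAC subrr add0r sq.2 // => h; lra.
  have sS : sublinear (fun z => inf (S z)).
    apply: sublinear_inf => //.
    - by move=> z; exists (q (z + of_real 0 *: y) - 0 * q y); exists 0 => /=.
    - move=> z w _ _ [t /= t0 <-] [s /= s0 <-].
      exists (q (z + w + of_real (t + s) *: y) - (t + s) * q y).
        by exists (t + s) => //=; exact: addr_ge0.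
      have := sq.1 (z + of_real t *: y) (w + of_real s *: y).
      rewrite addrACA -scalerDl -of_realD => h; lra.
    - move=> t z _ t0 [s /= s0 <-].
      exists (q (of_real t *: z + of_real (t * s) *: y) - (t * s) * q y).
        by exists (t * s) => //=; exact: mulr_ge0.
      by rewrite of_realM -scalerA -scalerDr sq.2 // mulrBr mulrA.
  have Sq z : inf (S z) <= q z.
    apply: ge_inf => //; exists 0 => //=.
    by rewrite of_real0 scale0r addr0 mul0r subr0.
  (* By minimality q x equals the infimum, whose member at t = 1 is q (x + y) - q y. *)
  have /(congr1 (fun f => f x)) /= <- := qmin _ sS Sq.
  rewrite -lerBrDr; apply: ge_inf => //; exists 1 => //=.
  by rewrite of_real1 scale1r mul1r.
have qD x y : q (x + y) = q x + q y.
  by apply/eqP; rewrite eq_le sq.1 supadd.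
have qN x : q (- x) = - q x.
  by apply/eqP; rewrite -addr_eq0 -qD addNr sublinear0.
exists q; split=> // a x.
have [a0|a0] := leP 0 a; first exact: sq.2.
rewrite -[a]opprK of_realN scaleNr qN sq.2 ?oppr_ge0 ?ltW //.
by rewrite -mulNr.
Qed.

End hahn_banach.

(** * Null sequences of seminorms *)

Section vanishing_seminorms.
Context {R : realType} {k : scalar_kind}.
Local Notation K := (scalars R k).

(** The bound by the norm may depend on [n] (it is 2^n for the interpolation seminorms); domination
    of the norm by the 0-th seminorm makes the inclusion of [c0_space] into [F] bounded. *)
Record seminorms (F : normedModType K) := Seminorms {
  seminorm :> nat -> F -> R ;
  seminormD : forall n x y, seminorm n (x + y) <= seminorm n x + seminorm n y ;
  seminormZ : forall n a x, seminorm n (a *: x) = rnorm a * seminorm n x ;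
  seminorm_le : forall n, exists C, forall x, seminorm n x <= C * rnorm x ;
  le_seminorm0 : exists C, forall x, rnorm x <= C * seminorm 0%N x }.

Section seminorm_theory.
Context {F : normedModType K} (p : seminorms F).

Lemma seminorm0 n : p n 0 = 0.
Proof. by rewrite -(scale0r 0) seminormZ rnorm0 mul0r. Qed.

Lemma seminormN n x : p n (- x) = p n x.
Proof. by rewrite -scaleN1r seminormZ rnormN rnorm1 mul1r. Qed.

Lemma seminorm_ge0 n x : 0 <= p n x.
Proof.
by have := seminormD p n x (- x); rewrite subrr seminorm0 seminormN => h; lra.
Qed.

Lemma seminorm_le_pos n : exists2 C, 0 < C & forall x, p n x <= C * rnorm x.
Proof.
have [C hC] := seminorm_le p n; exists (`|C| + 1); first by rewrite ltr_wpDl.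
move=> x; apply: le_trans (hC x) _; rewrite ler_wpM2r ?rnorm_ge0 //.
by apply: le_trans (ler_norm _) _; rewrite lerDl.
Qed.

Lemma le_seminorm0_pos : exists2 C, 0 < C & forall x, rnorm x <= C * p 0%N x.
Proof.
have [C hC] := le_seminorm0 p; exists (`|C| + 1); first by rewrite ltr_wpDl.
move=> x; apply: le_trans (hC x) _; rewrite ler_wpM2r ?seminorm_ge0 //.
by apply: le_trans (ler_norm _) _; rewrite lerDl.
Qed.

Definition vanishing : {pred F} := fun x =>
  `[< forall e : R, 0 < e -> exists N, forall n, (N <= n)%N -> p n x <= e >].

Lemma vanishing_closed : subsemimod_closed vanishing.
Proof.
split; first split.
- by apply/asboolP => e e0; exists 0%N => n _; rewrite seminorm0 ltW.
- move=> x y /asboolP vx /asboolP vy; apply/asboolP => e e0.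
  have e2 : 0 < e / 2 by rewrite divr_gt0.
  have [N hN] := vx _ e2; have [M hM] := vy _ e2.
  exists (maxn N M) => n; rewrite geq_max => /andP[/hN xn /hM yn].
  apply: le_trans (seminormD _ _ _ _) _; lra.
- move=> a x /asboolP vx; apply/asboolP => e e0.
  have a1 : 0 < rnorm a + 1 by rewrite ltr_wpDl ?rnorm_ge0.
  have [N hN] := vx _ (divr_gt0 e0 a1); exists N => n /hN xn.
  rewrite seminormZ; apply: le_trans (ler_wpM2l (rnorm_ge0 a) xn) _.
  rewrite mulrA ler_pdivrMr // mulrC ler_pM2l //; lra.
Qed.

HB.instance Definition _ := GRing.isSubmodClosed.Build K F vanishing vanishing_closed.

(** A type of its own, so that the subspace carries the supremum norm instead of the norm of [F]. *)
Record c0_space := C0Space { c0_val :> F ; c0P : c0_val \in vanishing }.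

HB.instance Definition _ := [isSub for c0_val].
HB.instance Definition _ := [Choice of c0_space by <:].
HB.instance Definition _ := [SubChoice_isSubLmodule of c0_space by <:].

Definition c0_norm (x : c0_space) : R := sup (range (fun n => p n x)).

Lemma c0_has_sup (x : c0_space) : has_sup (range (fun n => p n x)).
Proof.
split; first by exists (p 0%N x); exists 0%N.
have /asboolP/(_ 1 ltr01)[N hN] := c0P x.
exists (1 + \sum_(i < N) p i x) => _ [n _ <-].
have s0 (P : pred 'I_N) : 0 <= \sum_(i < N | P i) p i x.
  by apply: sumr_ge0 => i _; exact: seminorm_ge0.
have [Nn|nN] := leqP N n.
  by apply: le_trans (hN n Nn) _; rewrite lerDl s0.
by rewrite (bigD1 (Ordinal nN)) //= addrCA lerDl addr_ge0.
Qed.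

Lemma le_c0_norm (x : c0_space) n : p n x <= c0_norm x.
Proof. by apply: ub_le_sup; [exact: (c0_has_sup x).2|exists n]. Qed.

Lemma c0_norm_le (x : c0_space) c : (forall n, p n x <= c) -> c0_norm x <= c.
Proof.
move=> xc; apply: ge_sup; first exact: (c0_has_sup x).1.
by move=> _ [n _ <-].
Qed.

Lemma c0_norm_ge0 x : 0 <= c0_norm x.
Proof. exact: le_trans (seminorm_ge0 0%N x) (le_c0_norm _ _). Qed.

Lemma c0_normD x y : of_real (c0_norm (x + y)) <= of_real (c0_norm x) + of_real (c0_norm y) :> K.
Proof.
rewrite -of_realD ler_of_real; apply: c0_norm_le => n.
by apply: le_trans (seminormD _ _ _ _) _; rewrite lerD ?le_c0_norm.
Qed.

Lemma c0_normZ_real a x : c0_norm (a *: x) = rnorm a * c0_norm x.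
Proof.
have le b y : c0_norm (b *: y) <= rnorm b * c0_norm y.
  by apply: c0_norm_le => n; rewrite seminormZ ler_wpM2l ?rnorm_ge0 ?le_c0_norm.
apply/eqP; rewrite eq_le le /=.
have [->|a0] := eqVneq a 0; first by rewrite rnorm0 mul0r c0_norm_ge0.
(* The reverse inequality is the first one for the scalar a^-1 and the vector a x. *)
rewrite -[x in leLHS](scalerK a0); apply: le_trans (ler_wpM2l (rnorm_ge0 a) (le _ _)) _.
by rewrite mulrA -rnormM divff // rnorm1 mul1r.
Qed.

Lemma c0_normZ a x : of_real (c0_norm (a *: x)) = `|a| * of_real (c0_norm x).
Proof. by rewrite c0_normZ_real of_realM -normE. Qed.

Lemma c0_norm0_eq0 x : of_real (c0_norm x) = 0 :> K -> x = 0.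
Proof.
rewrite -of_real0 => /(can_inj of_realK) x0.
apply/val_inj/rnorm0_eq0/le_anti; rewrite rnorm_ge0 andbT.
have [C _ hC] := le_seminorm0_pos; apply: le_trans (hC _) _.
suff -> : p 0%N (val x) = 0 by rewrite mulr0.
by apply/le_anti; rewrite seminorm_ge0 andbT -x0 le_c0_norm.
Qed.

HB.instance Definition _ := Lmodule_isNormed.Build K c0_space c0_normD c0_normZ c0_norm0_eq0.

Lemma rnorm_c0 (x : c0_space) : rnorm x = c0_norm x.
Proof. exact: of_realK. Qed.

Lemma c0_val_bound : exists2 C : R, 0 < C &
  forall x : c0_space, rnorm (c0_val x) <= C * rnorm x.
Proof.
have [C C0 hC] := le_seminorm0_pos; exists C => // x.
by apply: le_trans (hC _) _; rewrite rnorm_c0 ler_pM2l ?le_c0_norm.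
Qed.

End seminorm_theory.

Lemma cauchy_rdist (V : normedModType K) (A : set_system V) :
  ProperFilter A -> cauchy A -> forall e : R, 0 < e ->
  exists2 U, A U & forall u v, U u -> U v -> rnorm (u - v) <= e.
Proof.
move=> PA /cauchyP cA e e0.
have e2 : 0 < of_real (e / 2) :> K by rewrite -of_real0 ltr_of_real divr_gt0.
have [x Ax] := cA _ e2; exists (ball x (of_real (e / 2))) => // u v.
rewrite -ball_normE /= !normE !ltr_of_real => xu xv.
apply: le_trans (rdistD _ x _) _; rewrite rdistC; lra.
Qed.

Lemma rdist_cauchy (V : normedModType K) (A : set_system V) :
  ProperFilter A -> (forall e : R, 0 < e ->
    exists2 U, A U & forall u v, U u -> U v -> rnorm (u - v) <= e) -> cauchy A.
Proof.
move=> PA H; apply: cauchy_exP => e e0.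
have r0 : 0 < real_part e / 2.
  by rewrite divr_gt0 // -(@ltr_of_real _ k) of_real0 -ge0_of_real ?ltW.
have [U AU hU] := H _ r0; have [u Uu] := filter_ex AU.
exists u; apply: filterS AU => v Uv.
rewrite -ball_normE /= (ge0_of_real (ltW e0)) normE ltr_of_real.
apply: le_lt_trans (hU _ _ Uu Uv) _; lra.
Qed.

Lemma cvg_rdist (V : normedModType K) (A : set_system V) (FA : Filter A) (y : V) :
  A --> y <-> forall e : R, 0 < e -> A [set x | rnorm (y - x) <= e].
Proof.
split=> [/cvgrPdist_le H e e0|H].
  have := H (of_real e); rewrite -of_real0 ltr_of_real => /(_ e0).
  by apply: filterS => x /=; rewrite normE ler_of_real.
apply/cvgrPdist_le => e e0; have r0 : 0 < real_part e.
  by rewrite -(@ltr_of_real _ k) of_real0 -ge0_of_real ?ltW.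
apply: filterS (H _ r0) => x /= xe.
by rewrite normE (ge0_of_real (ltW e0)) ler_of_real.
Qed.

(** * Completeness of the space of null sequences *)

Section completeness.
Context {F : completeNormedModType K} (p : seminorms F).

(** The filter converges in [F], and since each seminorm is continuous there, the Cauchy estimate
    passes to the limit uniformly in n. *)
Lemma c0_complete (A : set_system (c0_space p)) :
  ProperFilter A -> cauchy A -> cvg A.
Proof.
move=> PA /(cauchy_rdist PA) cA.
have [C C0 hC] := c0_val_bound p.
have : cvg (@c0_val _ p @ A).
  apply: cauchy_cvg; apply: rdist_cauchy => e e0.
  have [U AU hU] := cA _ (divr_gt0 e0 C0).
  exists (@c0_val _ p @` U).
    by apply: (@filterS _ A _ U) => // x Ux; exists x.
  move=> _ _ [x Ux <-] [y Uy <-].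
  apply: le_trans (hC (x - y)) _.
  by rewrite mulrC -ler_pdivlMr // hU.
move=> /cvg_ex[y /cvg_rdist yA].
have {}yA e : 0 < e -> A [set x | rnorm (y - c0_val x) <= e] := yA e.
have near_y e : 0 < e -> exists2 U, A U & forall u n, U u -> p n (y - c0_val u) <= e.
  move=> e0; have e2 : 0 < e / 2 by rewrite divr_gt0.
  have [U AU hU] := cA _ e2; exists U => // u n Uu.
  (* The point v below is close to y relative to the n-th seminorm and so depends on n, whereas U
     does not. *)
  have [D D0 hD] := seminorm_le_pos p n.
  have [v [Uv yv]] := filter_ex (filterI AU (yA _ (divr_gt0 e2 D0))).
  rewrite -(subrK (c0_val v) y) -addrA; apply: le_trans (seminormD _ _ _ _) _.
  rewrite (splitr e); apply: lerD.
    by apply: le_trans (hD _) _; rewrite mulrC -ler_pdivlMr.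
  apply: le_trans (hU _ _ Uv Uu); rewrite rnorm_c0.
  exact: (le_c0_norm (v - u)).
have vy : y \in vanishing p.
  apply/asboolP => e e0; have e2 : 0 < e / 2 by rewrite divr_gt0.
  have [U AU hU] := near_y _ e2; have [u Uu] := filter_ex AU.
  have /asboolP/(_ _ e2)[N hN] := c0P u; exists N => n /hN un.
  rewrite -(subrK (c0_val u) y); apply: le_trans (seminormD _ _ _ _) _.
  by rewrite (splitr e) lerD ?hU.
apply/cvg_ex; exists (C0Space vy); apply/cvg_rdist => e e0.
have [U AU hU] := near_y _ e0; apply: filterS AU => u Uu /=.
rewrite rnorm_c0; apply: c0_norm_le => n; exact: hU.
Qed.

HB.instance Definition _ := Uniform_isComplete.Build (c0_space p) c0_complete.

End completeness.
End vanishing_seminorms.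

(** * The interpolation space *)

Section bounded_operators.
Context {R : realType} {k : scalar_kind}.
Local Notation K := (scalars R k).

Lemma bounded_of_le (E F : normedModType K) (f : E -> F) (C : R) :
  linear f -> (forall x, rnorm (f x) <= C * rnorm x) -> bounded_near f (nbhs (0 : E)).
Proof.
move=> lf fC.
pose g : {linear E -> F} := HB.pack f (GRing.isLinear.Build _ _ _ _ f lf).
apply/(linear_boundedP g); exists (of_real C); split.
  by rewrite realE -of_real0 !ler_of_real le_total.
move=> M CM x; rewrite -[leLHS]/(`|f x|); apply: le_trans (ler_wpM2r _ (ltW CM)) => //.
by rewrite (normE x) -of_realM normE ler_of_real.
Qed.

Lemma operator_bound (E F : normedModType K) (T : operator E F) :
  exists2 C : R, 0 < C & forall x, rnorm (T x) <= C * rnorm x.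
Proof.
have /linear_boundedP[M [Mr hM]] := op_bounded T.
have M1 : M < `|M| + 1 by rewrite (le_lt_trans (real_ler_norm Mr)) // ltrDl.
exists (rnorm M + 1); first by rewrite ltr_wpDl ?rnorm_ge0.
move=> x; rewrite -(@ler_of_real _ k) of_realM of_realD of_real1 -!normE.
exact: hM.
Qed.

Definition mk_operator (E F : normedModType K) (f : E -> F) (C : R)
    (lf : linear f) (fC : forall x, rnorm (f x) <= C * rnorm x) : operator E F :=
  Operator lf (bounded_of_le lf fC).

End bounded_operators.

Section interpolation.
Context {R : realType} {k : scalar_kind}.
Local Notation K := (scalars R k).
Context {E F : normedModType K} (T : operator E F).

Let cost n y x : R := (2 ^+ n)^-1 * rnorm x + 2 ^+ n * rnorm (y - T x).

(** Up to a factor 2 this is the gauge of 2^n T(B_E) + 2^-n B_F from the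
    Davis-Figiel-Johnson-Pelczynski construction. *)
Definition interp n y : R := inf (range (cost n y)).

Let pow2_gt0 n : 0 < 2 ^+ n :> R. Proof. by rewrite exprn_gt0. Qed.

Let cost_ge0 n y x : 0 <= cost n y x.
Proof. by rewrite addr_ge0 // mulr_ge0 ?rnorm_ge0 ?invr_ge0 // ltW. Qed.

Let cost_lb n y : has_lbound (range (cost n y)).
Proof. by exists 0 => _ [x _ <-]. Qed.

Let cost_neq0 n y : range (cost n y) !=set0.
Proof. by exists (cost n y 0), 0. Qed.

Lemma interp_le n y x : interp n y <= (2 ^+ n)^-1 * rnorm x + 2 ^+ n * rnorm (y - T x).
Proof. by apply: ge_inf => //; exists x. Qed.

Lemma le_interp n y c v : 0 <= c -> (forall x, v <= c * cost n y x) -> v <= c * interp n y.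
Proof.
rewrite le_eqVlt => /predU1P[<-|c0] H; first by have := H 0; rewrite !mul0r.
rewrite -ler_pdivrMl //; apply: lb_le_inf => // _ [x _ <-].
by rewrite ler_pdivrMl.
Qed.

Lemma interpD n x y : interp n (x + y) <= interp n x + interp n y.
Proof.
suff [+ _] : sublinear (interp n) by apply.
apply: sublinear_inf => // [u v _ _ [x1 _ <-] [x2 _ <-]|t u _ t0 [x1 _ <-]].
  exists (cost n (u + v) (x1 + x2)); first by exists (x1 + x2).
  rewrite /cost raddfD opprD addrACA [leRHS]addrACA -!mulrDr.
  by apply: lerD; rewrite ler_pM2l ?invr_gt0 ?rnormD.
exists (cost n (of_real t *: u) (of_real t *: x1)); first by exists (of_real t *: x1).
rewrite /cost linearZ -scalerBr !rnormZ rnorm_of_real ger0_norm //.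
by rewrite mulrDr !(mulrCA t).
Qed.

Lemma interpZ n a x : interp n (a *: x) = rnorm a * interp n x.
Proof.
have le b y : interp n (b *: y) <= rnorm b * interp n y.
  apply: le_interp => [|z]; first exact: rnorm_ge0.
  apply: le_trans (interp_le n (b *: y) (b *: z)) _.
  by rewrite linearZ -scalerBr !rnormZ mulrDr !(mulrCA (rnorm b)).
apply/eqP; rewrite eq_le le /=.
have [->|a0] := eqVneq a 0.
  by rewrite rnorm0 mul0r lb_le_inf // => _ [z _ <-].
rewrite -[x in leLHS](scalerK a0); apply: le_trans (ler_wpM2l (rnorm_ge0 a) (le _ _)) _.
by rewrite mulrA -rnormM divff // rnorm1 mul1r.
Qed.

Lemma interp_le_norm n y : interp n y <= 2 ^+ n * rnorm y.
Proof.
by apply: le_trans (interp_le n y 0) _; rewrite linear0 subr0 rnorm0 mulr0 add0r.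
Qed.

Lemma interp_image n x : interp n (T x) <= (2 ^+ n)^-1 * rnorm x.
Proof.
by apply: le_trans (interp_le n (T x) x) _; rewrite subrr rnorm0 mulr0 addr0.
Qed.

(** Write y = T x + (y - T x): the bounds a |x| and b |y - T x| are the two costs multiplied by 2^n
    a and 2^-n b. For large n the second coefficient is negligible, so the size of f on the range of
    T decides. *)
Lemma functional_le_interp n (V : normedModType K) (f : operator F V) (a b : R) :
  0 <= a -> 0 <= b -> (forall x, rnorm (f (T x)) <= a * rnorm x) ->
  (forall y, rnorm (f y) <= b * rnorm y) ->
  forall y, rnorm (f y) <= (2 ^+ n * a + (2 ^+ n)^-1 * b) * interp n y.
Proof.
move=> a0 b0 fa fb y.
have n0 := pow2_gt0 n; have n1 : 0 <= (2 ^+ n)^-1 :> R by rewrite invr_ge0 ltW.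
apply: le_interp => [|x]; first by rewrite addr_ge0 // mulr_ge0 // ltW.
rewrite -{1}(subrK (T x) y) raddfD; apply: le_trans (rnormD _ _) _.
have := fa x; have := fb (y - T x); rewrite /cost mulrDr !mulrDl.
rewrite mulrACA divff ?gt_eqF // mul1r.
rewrite [_^-1 * b * (2 ^+ n * _)]mulrACA mulVf ?gt_eqF // mul1r.
set u := rnorm x; set v := rnorm (y - T x) => h1 h2.
(* The cross terms of the expanded product are nonnegative and are dropped. *)
have : 0 <= (2 ^+ n)^-1 * b * ((2 ^+ n)^-1 * u).
  by rewrite !mulr_ge0 ?rnorm_ge0.
have : 0 <= 2 ^+ n * a * (2 ^+ n * v).
  by rewrite !mulr_ge0 ?rnorm_ge0 // ltW.
lra.
Qed.

(** This is the preceding estimate at n = 0 for the identity of [F], with a = |T| up to a bound and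
    b = 1. *)
Lemma norm_le_interp0 : exists C, forall y, rnorm y <= C * interp 0%N y.
Proof.
have [C C0 TC] := operator_bound T.
exists (1 * C + 1^-1 * 1) => y.
have := @functional_le_interp 0%N F (id_op F) C 1 (ltW C0) ler01 TC.
by rewrite expr0; apply => z; rewrite mul1r.
Qed.

Definition interp_seminorms : seminorms F :=
  Seminorms interpD interpZ
    (fun n => ex_intro _ (2 ^+ n) (interp_le_norm n)) norm_le_interp0.

Lemma image_vanishing x : T x \in vanishing interp_seminorms.
Proof.
apply/asboolP => e e0.
have [N hN] : exists N : nat, rnorm x / e <= 2 ^+ N.
  exists (Num.bound (rnorm x / e)); apply: le_trans (ltW (archi_boundP _)) _.
    by rewrite divr_ge0 ?rnorm_ge0 // ltW.
  by rewrite -natrX ler_nat ltnW // ltn_expl.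
exists N => n Nn; apply: le_trans (interp_image n x) _.
rewrite ler_pdivrMl // -ler_pdivrMr //; apply: le_trans hN _.
by rewrite ler_weXn2l // ler1n.
Qed.

Definition interp_in x : c0_space interp_seminorms := C0Space (image_vanishing x).

Lemma interp_in_linear : linear interp_in.
Proof. by move=> a x y; apply: val_inj; rewrite /= linearP. Qed.

Lemma interp_in_le x : rnorm (interp_in x) <= 1 * rnorm x.
Proof.
rewrite mul1r rnorm_c0; apply: c0_norm_le => n /=; apply: le_trans (interp_image n x) _.
by rewrite ler_piMl ?rnorm_ge0 // invf_le1 // exprn_ege1 // ler1n.
Qed.

Definition interp_in_op := mk_operator interp_in_linear interp_in_le.

End interpolation.

Section inclusion.
Context {R : realType} {k : scalar_kind}.
Local Notation K := (scalars R k).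
Context {F : normedModType K} (p : seminorms F).

Lemma c0_val_linear : linear (@c0_val _ _ _ p).
Proof. by []. Qed.

Lemma c0_val_bounded : bounded_near (@c0_val _ _ _ p) (nbhs (0 : c0_space p)).
Proof. by have [C _] := c0_val_bound p; exact: bounded_of_le c0_val_linear. Qed.

Definition c0_incl : operator (c0_space p) F := Operator c0_val_linear c0_val_bounded.

End inclusion.

(** * Splitting functionals *)

Section splitting.
Context {R : realType} {k : scalar_kind}.
Local Notation K := (scalars R k).
Context {F : normedModType K} (p : seminorms F) (N : nat).

Let head_bound w : exists2 B, 0 <= B & forall n, (n < N)%N -> p n w <= B.
Proof.
have s0 (P : pred 'I_N) : 0 <= \sum_(i < N | P i) p i w.
  by apply: sumr_ge0 => i _; exact: seminorm_ge0.
exists (\sum_(i < N) p i w) => // n nN.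
by rewrite (bigD1 (Ordinal nN)) //= lerDl.
Qed.

Let head_bound_norm : exists2 M, 0 < M & forall n w, (n < N)%N -> p n w <= M * rnorm w.
Proof.
elim: (N) => [|m [M M0 hM]]; first by exists 1.
have [C C0 hC] := seminorm_le_pos p m; exists (M + C); first exact: addr_gt0.
move=> n w; rewrite ltnS leq_eqVlt mulrDl => /orP[/eqP ->|nm].
  by apply: le_trans (hC w) _; rewrite lerDr mulr_ge0 ?rnorm_ge0 // ltW.
by apply: le_trans (hM _ w nm) _; rewrite lerDl mulr_ge0 ?rnorm_ge0 // ltW.
Qed.

(* Hahn-Banach on the diagonal of F x G, normed by the maximum of the first N
   seminorms of u and the remaining ones of v. *)
Lemma split_functional (h : dual (c0_space p)) (r : R) : 0 <= r ->
  (forall v, rnorm (h v) <= r * rnorm v) ->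
  exists f : {linear F -> K^o}, forall (u : F) (v : c0_space p) c,
    (forall n, (n < N)%N -> p n u <= c) -> (forall n, (N <= n)%N -> p n v <= c) ->
    rnorm (f u) + rnorm (h v - f (c0_val v)) <= r * c.
Proof.
move=> r0 hr.
(* The extension takes the value f(w) at (w, 0). As (w + v, v) = (w, 0) + (v, v), its domination
   says that Re f(w) <= r c - Re h(v) whenever c bounds the norm of (w + v, v). *)
pose S w := [set s | exists (v : c0_space p) c,
  [/\ forall n, (n < N)%N -> p n (w + c0_val v) <= c,
      forall n, (N <= n)%N -> p n v <= c & s = r * c - real_part (h v)]].
have Sb w : has_lbound (S w).
  have [B B0 hB] := head_bound w; exists (- (r * B)) => _ [v [c [uc vc ->]]].
  have c0 : 0 <= c := le_trans (seminorm_ge0 p N v) (vc _ (leqnn _)).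
  (* For n < N, p_n(v) <= p_n(w + v) + p_n(w) <= c + B. *)
  have vcB : rnorm v <= c + B.
    rewrite rnorm_c0; apply: c0_norm_le => n.
    have [/vc nv|nN] := leqP N n; first by rewrite ler_wpDr.
    rewrite -[c0_val v](addKr w); apply: le_trans (seminormD _ _ _ _) _.
    by rewrite seminormN addrC lerD ?uc ?hB.
  have := le_trans (real_part_le_norm (h v)) (hr v).
  have := ler_wpM2l r0 vcB; rewrite mulrDr; lra.
have sS : sublinear (fun w => inf (S w)).
  apply: sublinear_inf => // [w|w1 w2 a b|t w a t0].
  - have [B B0 hB] := head_bound w; exists (r * B - real_part (h 0)).
    exists 0, B; split=> // n nN; first by rewrite addr0 hB.
    by rewrite seminorm0.
  - move=> [v1 [c1 [u1 hv1 ->]]] [v2 [c2 [u2 hv2 ->]]].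
    exists (r * (c1 + c2) - real_part (h (v1 + v2))).
      exists (v1 + v2), (c1 + c2); split=> // n nN.
        rewrite [c0_val _]/(c0_val v1 + c0_val v2) addrACA.
        by apply: le_trans (seminormD _ _ _ _) _; rewrite lerD ?u1 ?u2.
      by apply: le_trans (seminormD _ _ _ _) _; rewrite lerD ?hv1 ?hv2.
    by rewrite raddfD real_partD mulrDr; lra.
  - move=> [v [c [uc vc ->]]].
    exists (r * (t * c) - real_part (h (of_real t *: v))).
      exists (of_real t *: v), (t * c); split=> // n nN.
        rewrite [c0_val _]/(of_real t *: c0_val v) -scalerDr seminormZ.
        by rewrite rnorm_of_real ger0_norm // ler_wpM2l // uc.
      rewrite [c0_val _]/(of_real t *: c0_val v) seminormZ.
      by rewrite rnorm_of_real ger0_norm // ler_wpM2l // vc.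
    by rewrite linearZ real_part_mul; lra.
have [f [fD fZ fS]] := hahn_banach sS.
have [g gf] := complexify fD fZ; exists g => // u v c uc vc.
(* The phases a and b turn both moduli into real parts; the domination is then used at w = a u - b v
   with the vector b v, so that w + b v = a u. *)
have [a a1 au] := rotate_to_rnorm (g u).
have [b b1 bv] := rotate_to_rnorm (h v - g (c0_val v)).
have : f (a *: u - b *: c0_val v) <= r * c - real_part (h (b *: v)).
  apply: le_trans (fS _) _; apply: ge_inf => //; exists (b *: v), c.
  split=> // n nN; first by rewrite subrK seminormZ a1 mul1r uc.
  by rewrite [c0_val _]/(b *: c0_val v) seminormZ b1 mul1r vc.
rewrite -gf raddfB /= real_partD real_partN !(functionalZ g) (functionalZ h).
by rewrite au -bv mulrBr real_partD real_partN; lra.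
Qed.

(** [M] bounds the first N seminorms by the norm, hence is uniform in [h], [r] and [d]. The part g
    of the splitting satisfies |g| <= r M <= M, and [f] is g / M. *)
Lemma local_functionals (y : c0_space p) : rnorm y <= 1 ->
  (forall n, (N <= n)%N -> p n y <= 4^-1) ->
  exists2 M, 0 < M & forall (h : dual (c0_space p)) (r d : R), 0 <= r <= 1 ->
    (forall v, rnorm (h v) <= r * rnorm v) -> r - d < rnorm (h y) ->
    exists2 f : dual F, (forall u, rnorm (f u) <= rnorm u) &
      forall v, rnorm v <= 1 -> rnorm (h v - of_real M * f (c0_val v)) <= 2 * d.
Proof.
move=> y1 yN; have [M M0 hM] := head_bound_norm; exists M => // h r d /andP[r0 r1] hr hy.
have [g gh] := split_functional r0 hr.
have gM u : rnorm (g u) <= M * rnorm u.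
  have Mu0 : 0 <= M * rnorm u by rewrite mulr_ge0 ?rnorm_ge0 // ltW.
  have u0 n : (N <= n)%N -> p n (c0_val (0 : c0_space p)) <= M * rnorm u.
    by rewrite seminorm0.
  have := gh u 0 _ (fun n => hM n u) u0.
  have := ler_wpM2r Mu0 r1; rewrite mul1r.
  have := rnorm_ge0 (h 0 - g (c0_val (0 : c0_space p))); lra.
have lf : linear (fun u => of_real M^-1 * g u : K^o).
  by move=> a u v; rewrite linearP mulrDr mulrCA.
have fM u : rnorm (of_real M^-1 * g u : K^o) <= 1 * rnorm u.
  rewrite mul1r rnormM rnorm_of_real ger0_norm ?invr_ge0 ?(ltW M0) //.
  by rewrite ler_pdivrMl.
exists (mk_operator lf fM) => [u|v v1] /=; first by rewrite -[leRHS]mul1r.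
rewrite mulrA -of_realM divff ?gt_eqF // of_real1 mul1r.
have pn (x : c0_space p) c n : rnorm x <= c -> p n (c0_val x) <= c.
  by apply: le_trans; rewrite rnorm_c0; exact: le_c0_norm.
have := gh (c0_val y) v 1 (fun n _ => pn _ _ n y1) (fun n _ => pn _ _ n v1).
(* The pair (y, 4 y) is admissible because the tail of y is at most 1/4. With h' = h - g it gives |g
   y| + 4 |h' y| <= r; together with |h y| > r - d this yields |h' y| < d/3 and |g y| > r - 4d/3,
   and the pair (y, v) then gives |h' v| < 4d/3. *)
have : rnorm (g (c0_val y)) + rnorm (h (of_real 4 *: y) - g (of_real 4 *: c0_val y)) <= r * 1.
  apply: (gh (c0_val y) (of_real 4 *: y) 1) => n nN; first exact: pn.
  rewrite [c0_val _]/(of_real 4 *: c0_val y) seminormZ rnorm_of_real ger0_norm //.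
  by have := yN n nN; lra.
rewrite (functionalZ h) (functionalZ g) -mulrBr.
rewrite rnormM rnorm_of_real ger0_norm // mulr1.
have := rnormD (h y - g (c0_val y)) (g (c0_val y)); rewrite subrK.
have := rnorm_ge0 (h y - g (c0_val y)); lra.
Qed.

End splitting.

(** * The weak* topology and Szlenk derivations *)

Section weak_star.
Context {R : realType} {k : scalar_kind}.
Local Notation K := (scalars R k).

Lemma dual_norm_le (E : normedModType K) (f : E -> K^o) (c : R) :
  (dual_norm f <= c%:E)%E <-> forall x, rnorm x <= 1 -> rnorm (f x) <= c.
Proof.
split=> [fc x x1|fc].
  rewrite -lee_fin; apply: le_trans fc; apply: ereal_sup_ubound; exists x => //=.
  by rewrite normE -of_real1 ler_of_real.
apply: ge_ereal_sup => _ [x /= x1 <-]; rewrite lee_fin; apply: fc.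
by rewrite -(@ler_of_real R k) -normE of_real1.
Qed.

Lemma unit_ball_le (E : normedModType K) (V : normedModType K) (f : {linear E -> V}) (c : R) :
  (forall x, rnorm x <= 1 -> rnorm (f x) <= c) -> forall x, rnorm (f x) <= c * rnorm x.
Proof.
move=> fc x; have := rnorm_ge0 x; rewrite le_eqVlt => /predU1P[x0|x0].
  by rewrite -x0 mulr0 (rnorm0_eq0 (esym x0)) linear0 rnorm0.
rewrite -ler_pdivrMr // mulrC -(ger0_norm (_ : 0 <= (rnorm x)^-1)) ?invr_ge0 ?(ltW x0) //.
rewrite -(@rnorm_of_real _ k) -rnormZ -linearZ; apply: fc.
by rewrite rnormZ rnorm_of_real ger0_norm ?invr_ge0 ?(ltW x0) // mulVf ?gt_eqF.
Qed.

Definition wstar_topology (E : normedModType K) : topologicalType :=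
  initial_topology (fun f : dual E => (op_fun f : {ptws E -> K^o})).

Lemma wstar_open_eval (E : normedModType K) (x : E) (O : set K^o) :
  open O -> wstar_open [set f : dual E | O (f x)].
Proof.
move=> oO; exists [set u : {ptws E -> K^o} | O (u x)] => //.
have /continuousP c : continuous (fun u : {ptws E -> K^o} => u x).
  exact: (@proj_continuous E (fun=> K^o) x).
exact: c.
Qed.

Lemma wstar_open_near (E : normedModType K) (x : E) (z : K) (e : R) :
  wstar_open [set f : dual E | rnorm (f x - z) < e].
Proof.
apply: (@wstar_open_eval E x [set w | rnorm (w - z) < e]).
rewrite openE => w /= we; apply/nbhs_ballP.
exists (of_real (e - rnorm (w - z))) => /=; first by rewrite -of_real0 ltr_of_real subr_gt0.
move=> u; rewrite -ball_normE /= normE ltr_of_real => wu.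
apply: le_lt_trans (rdistD u w z) _; rewrite rdistC -ltrBrDr; exact: wu.
Qed.

Lemma wstar_open_gt (E : normedModType K) (x : E) (c : R) :
  wstar_open [set f : dual E | c < rnorm (f x)].
Proof.
apply: (@wstar_open_eval E x [set w | c < rnorm w]).
rewrite openE => w /= cw; apply/nbhs_ballP.
exists (of_real (rnorm w - c)) => /=; first by rewrite -of_real0 ltr_of_real subr_gt0.
move=> u; rewrite -ball_normE /= normE ltr_of_real => wu.
rewrite -(ltrD2l (rnorm (w - u))); apply: lt_le_trans (rnormD _ _).
by rewrite subrK -ltrBrDr ltrBDl in wu *.
Qed.

Lemma wstar_openI (E : normedModType K) (U V : set (dual E)) :
  wstar_open U -> wstar_open V -> wstar_open (U `&` V).
Proof. exact: (@openI (wstar_topology E)). Qed.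

Lemma wstar_openT (E : normedModType K) : wstar_open [set: dual E].
Proof. exact: (@openT (wstar_topology E)). Qed.

(** Weak* convergence in pointwise form, which keeps the initial topology out of the limit
    arguments. *)
Definition wstar_cvg (E : normedModType K) (A : set_system (dual E)) (f : dual E) :=
  forall x (e : R), 0 < e -> A [set g | rnorm (g x - f x) <= e].

Lemma wstar_cvg_open (E : normedModType K) (A : set_system (dual E)) f V :
  Filter A -> wstar_cvg A f -> wstar_open V -> V f -> A V.
Proof.
move=> FA Af [U oU <-] fU.
suff : (fun g : dual E => (op_fun g : {ptws E -> K^o})) @ A --> (op_fun f : {ptws E -> K^o}).
  by apply; apply: open_nbhs_nbhs.
apply/cvg_sup => x U' [W [[W' oW' <-] W'f WU]].
have : nbhs (f x : K^o) W' by apply: open_nbhs_nbhs.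
move=> /nbhs_ballP[e /= e0 eW'].
have r0 : 0 < real_part e / 2.
  by rewrite divr_gt0 // -(@ltr_of_real _ k) of_real0 -ge0_of_real ?ltW.
apply: (@filterS _ A _ [set g | rnorm (g x - f x) <= real_part e / 2]); last exact: Af.
move=> g /= ge; apply: WU; apply: eW'.
rewrite -ball_normE /= (ge0_of_real (ltW e0)) normE ltr_of_real rdistC; lra.
Qed.

Lemma wstar_cvg_adjoint (E F : normedModType K) (T : operator E F) A f :
  wstar_cvg A f -> wstar_cvg (adjoint T @ A) (adjoint T f).
Proof. by move=> Af x; exact: Af. Qed.

(** Along an ultrafilter every evaluation stays in a compact set of scalars and so converges;
    linearity and the norm bound pass to the pointwise limit. *)
Lemma alaoglu (F : normedModType K) (A : set_system (dual F)) :
  UltraFilter A -> A [set f | forall x, rnorm (f x) <= rnorm x] ->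
  exists2 f : dual F, (forall x, rnorm (f x) <= rnorm x) & wstar_cvg A f.
Proof.
move=> UA Aball.
have /choice[l hl] : forall x, exists z : K^o, forall e : R, 0 < e ->
    A [set g | rnorm (g x - z) <= e].
  move=> x; have [C cC hC] := @closed_ball_subset_compact R k (rnorm x).
  have AC : A [set g : dual F | C (g x)].
    by apply: filterS Aball => g gx; exact: (hC (g x) (gx x)).
  have [z [Cz zA]] := cC ((fun g : dual F => (g x : K^o)) @ A) (fmap_proper_filter _ _) AC.
  exists z => e e0.
  have [//|An] := in_ultra_setVsetC [set g : dual F | rnorm (g x - z) <= e] UA.
  have eK : 0 < of_real e :> K by rewrite -of_real0 ltr_of_real.
  have [w [nw]] := zA [set w | ~ (rnorm (w - z) <= e)] (ball z (of_real e)) An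
    (nbhsx_ballx _ _ eK).
  rewrite -ball_normE /= normE ltr_of_real rdistC => /ltW wz.
  by case: nw.
have near0 (z : K^o) (c : R) : (forall e, 0 < e -> rnorm z <= c + e) -> rnorm z <= c.
  by move=> H; apply/ler_addgt0Pr => e /H.
have ll : linear l.
  move=> a x y; apply/eqP; rewrite -subr_eq0; apply/eqP/rnorm0_eq0/le_anti.
  rewrite rnorm_ge0 andbT; apply: near0 => e e0; rewrite add0r.
  (* With d = e / (|a| + 2) the three approximation errors |a| d, d and d add up to e. *)
  have a2 : 0 < rnorm a + 2 by rewrite ltr_wpDl ?rnorm_ge0.
  have d0 := divr_gt0 e0 a2; have := divfK (lt0r_neq0 a2) e; move: d0.
  set d := e / _ => d0; rewrite mulrC mulrDl => ed.
  have [g [[gx gy] gxy]] := filter_ex (filterI (filterI (hl x _ d0) (hl y _ d0)) (hl (a *: x + y) _ d0)).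
  have -> : l (a *: x + y) - (a *: l x + l y) =
      (g (a *: x + y) - (a *: l x + l y)) - (g (a *: x + y) - l (a *: x + y)).
    by rewrite [RHS]addrC opprB addrA subrK.
  rewrite {1}linearP opprD addrACA -scalerBr.
  apply: le_trans (rnormD _ _) _; rewrite rnormN.
  apply: le_trans (lerD (rnormD _ _) gxy) _; rewrite rnormZ.
  apply: (@le_trans _ _ (rnorm a * d + d + d)); last lra.
  by rewrite !lerD // ler_wpM2l ?rnorm_ge0.
have lb x : rnorm (l x) <= 1 * rnorm x.
  rewrite mul1r; apply: near0 => e e0.
  have [g [gx gl]] := filter_ex (filterI Aball (hl x e e0)).
  have := rdistD (l x) (g x) 0; rewrite !subr0 rdistC.
  have := gx x; move: gl => /=; lra.
by exists (mk_operator ll lb) => // x; rewrite -[leRHS]mul1r; exact: lb.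
Qed.

(** * Permanence properties of Szlenk derivations *)

Section szlenk_facts.
Variables (E : normedModType K) (eps : R).
Implicit Types A S : set (dual E).

(** If all of A were within eps/2 of g, its diameter would be at most eps by the triangle
    inequality. *)
Lemma diam_gt A (g : dual E) : (eps%:E < diam A)%E ->
  exists2 h, A h & exists2 v, rnorm v <= 1 & eps / 2 < rnorm (g v - h v).
Proof.
move=> Ad; apply: contrapT => H.
have hA h v : A h -> rnorm v <= 1 -> rnorm (g v - h v) <= eps / 2.
  move=> Ah v1; rewrite leNgt; apply/negP => hv.
  by apply: H; exists h => //; exists v.
move: Ad; apply/negP; rewrite -leNgt.
apply: ge_ereal_sup => _ [f Af [h Ah <-]]; apply/dual_norm_le => v v1 /=.
apply: le_trans (rdistD _ (g v) _) _; rewrite rdistC.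
have := hA _ _ Af v1; have := hA _ _ Ah v1; lra.
Qed.

Lemma diam_le A f g v : (diam A <= eps%:E)%E -> A f -> A g -> rnorm v <= 1 ->
  rnorm (f v - g v) <= eps.
Proof.
move=> Ad Af Ag.
have /dual_norm_le H : (dual_norm (f \- g)%R <= eps%:E)%E; last exact: H.
apply: le_trans Ad; apply: ereal_sup_ubound; exists f => //; by exists g.
Qed.

Lemma szlenk_iter_mono A S b : A `<=` S -> szlenk_iter eps A b `<=` szlenk_iter eps S b.
Proof.
move=> AS; elim: b => [|b IH|I f IH] g /=; first exact: AS.
  move=> [gA gV]; split=> [|V oV Vg]; first exact: IH.
  by apply: lt_le_trans (gV V oV Vg) _; apply: diam_sub; exact: setSI.
by move=> [Ag gI]; split=> [|i]; [exact: AS|exact/IH/gI].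
Qed.

(** Neighbourhoods of a point of V may be shrunk into V, so derivations at that point only see A
    inside V. *)
Lemma szlenk_iter_local A V b g : wstar_open V -> V g ->
  szlenk_iter eps A b g -> szlenk_iter eps (A `&` V) b g.
Proof.
move=> oV; elim: b g => [|b IH|I f IH] g Vg /=; first by [].
  move=> [gA gW]; split=> [|W oW Wg]; first exact: IH.
  have := gW _ (wstar_openI oV oW) (conj Vg Wg).
  move=> /lt_le_trans; apply; apply: diam_sub => h [hA [Vh Wh]].
  by split=> //; exact: IH.
by move=> [Ag gI]; split=> // i; exact: IH.
Qed.

(** Relative weak* closedness of the iterates: an open set around the limit is also a neighbourhood
    of some point of the derived set, hence meets the previous iterate in a set of large
    diameter. *)
Lemma szlenk_iter_closed A b (P : set_system (dual E)) g : ProperFilter P ->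
  wstar_cvg P g -> A g -> P (szlenk_iter eps A b) -> szlenk_iter eps A b g.
Proof.
move=> PP Pg Ag; elim: b => [|b IH|I f IH] /= Pb; first by [].
  split=> [|V oV Vg]; first by apply: IH; apply: filterS Pb => h [].
  have [h [[_ hV] Vh]] := filter_ex (filterI Pb (wstar_cvg_open _ Pg oV Vg)).
  exact: hV.
by split=> // i; apply: IH; apply: filterS Pb => h [_].
Qed.

Lemma szlenk_iter_oadd A a b :
  szlenk_iter eps A (oadd a b) `<=` szlenk_iter eps (szlenk_iter eps A a) b.
Proof.
elim: b => [|b IH|I f IH] g /=; first by [].
  move=> [gA gV]; split=> [|V oV Vg]; first exact: IH.
  by apply: lt_le_trans (gV V oV Vg) _; apply: diam_sub; exact: setSI.
by move=> [_ H]; split=> [|i]; [exact: (H None)|exact/IH/(H (Some i))].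
Qed.

End szlenk_facts.

End weak_star.

(** * Perturbation and the radius decrement *)

Section perturbation.
Context {R : realType} {k : scalar_kind}.
Local Notation K := (scalars R k).
Context {E F G : normedModType K} (T : operator E F) (B : operator G F).

Definition short (f : dual F) := forall x, rnorm (f x) <= rnorm x.

Lemma short_dual_ball f : short f -> dual_ball f.
Proof.
by move=> sf; apply/dual_norm_le => x x1; exact: le_trans (sf x) x1.
Qed.

(** This links the two duals: where T^* has small diameter on part of B_{F^*}, so does B^*, up to an
    error fixed beforehand. *)
Hypothesis BT : forall e, 0 < e -> exists2 C : R, 0 < C &
  forall (f f' : dual F) a, short f -> short f' ->
  (forall x, rnorm x <= 1 -> rnorm (f (T x) - f' (T x)) <= a) ->
  forall v, rnorm v <= 1 -> rnorm (f (B v) - f' (B v)) <= C * a + e.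

Let close M d (g : dual G) (f : dual F) :=
  forall v, rnorm v <= 1 -> rnorm (g v - of_real M * f (B v)) <= d.

(** The iterates live in the dual of [E] but are pulled back to F^*, where weak* limits of witnesses
    are taken. *)
Let image_iter e b (f : dual F) :=
  szlenk_iter e (adjoint T @` @dual_ball R k F) b (adjoint T f).

Let image_iter_closed e b (A : set_system (dual F)) f : ProperFilter A ->
  wstar_cvg A f -> short f -> A (image_iter e b) -> image_iter e b f.
Proof.
move=> PA Af sf Ab; apply: (szlenk_iter_closed (P := adjoint T @ A)) Ab.
  exact: wstar_cvg_adjoint.
by exists f => //; exact: short_dual_ball.
Qed.

(* Weak* limits of functionals f_V that are close to functionals g_V -> g are
   close to g, because the norm is weak* lower semicontinuous. *)
Let close_closed M d (A : set_system (dual F)) f g : 0 <= M -> ProperFilter A ->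
  wstar_cvg A f ->
  (forall V, wstar_open V -> V g -> A [set f' | exists2 h, V h & close M d h f']) ->
  close M d g f.
Proof.
move=> M0 PA Af Ag v v1; apply/ler_addgt0Pr => e e0.
have e2 : 0 < e / 2 by rewrite divr_gt0.
have M1 : 0 < M + 1 by rewrite ltr_wpDl.
have gV : [set h : dual G | rnorm (h v - g v) < e / 2] g by rewrite /= subrr rnorm0.
have [f' [[h hg hf] f'f]] := filter_ex (filterI (Ag _ (wstar_open_near v (g v) (e / 2)) gV)
  (Af (B v) _ (divr_gt0 e2 M1))).
have -> : d + e = e / 2 + (d + e / 2) by lra.
apply: le_trans (rdistD _ (h v) _) _; apply: lerD; first by rewrite rdistC ltW.
apply: le_trans (rdistD _ (of_real M * f' (B v)) _) _; apply: lerD; first exact: hf.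
rewrite -mulrBr rnormM rnorm_of_real ger0_norm //; apply: le_trans (ler_wpM2l M0 f'f) _.
by rewrite mulrA ler_pdivrMr // mulrC ler_pM2l // lerDl.
Qed.

(** Induction on [b], carrying witnesses along. A point g of a derived set is a weak* limit of
    points h far from g; a limit f of their witnesses f' is a witness for g, since T^* f' approaches
    T^* f weak* without becoming norm-close. *)
Lemma szlenk_perturb (S : set (dual G)) (eps M d : R) : 0 < eps -> 0 < M ->
  16 * d <= eps -> (forall g, S g -> exists2 f, short f & close M (2 * d) g f) ->
  exists2 e : R, 0 < e & forall b g, szlenk_iter eps S b g ->
    exists f, [/\ short f, image_iter e b f & close M (2 * d) g f].
Proof.
move=> eps0 M0 deps Sclose.
(* The error eps / (8 M) and e = eps / (8 M C) are chosen so that M (C e + eps / (8 M)) = eps /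
   4. *)
have [C C0 hC] := BT (divr_gt0 eps0 (mulr_gt0 (ltr0n R 8) M0)).
have e0 : 0 < eps / (8 * M * C) by rewrite divr_gt0 // !mulr_gt0.
exists (eps / (8 * M * C)) => //; move: e0; set e := eps / _ => e0.
have close_of (f f' : dual F) v : short f -> short f' -> rnorm v <= 1 ->
    (forall x, rnorm x <= 1 -> rnorm (f (T x) - f' (T x)) <= e) ->
    M * rnorm (f (B v) - f' (B v)) <= eps / 4.
  move=> sf sf' v1 ff'; apply: le_trans (ler_wpM2l (ltW M0) (hC f f' e sf sf' ff' v v1)) _.
  rewrite /e le_eqVlt; apply/orP; left; apply/eqP; field.
  by rewrite !gt_eqF.
elim=> [|b IH|I bs IH] g.
- move=> Sg; have [f sf gf] := Sclose g Sg.
  exists f; split=> //; exists f => //; exact: short_dual_ball.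
- move=> [gb gV].
  (* Witnesses of points h of V at distance more than eps/2 from g; they form a filter base as V
     shrinks to g. *)
  pose W V := [set f | [/\ short f, image_iter e b f & exists h,
    [/\ V h, close M (2 * d) h f &
        exists2 v, rnorm v <= 1 & eps / 2 < rnorm (g v - h v)]]].
  pose A := filter_from [set V | wstar_open V /\ V g] W.
  have PA : ProperFilter A.
    apply: filter_from_proper.
      apply: filter_from_filter; first by exists setT; split=> //; exact: wstar_openT.
      move=> U V [oU Ug] [oV Vg]; exists (U `&` V); first by split=> //; exact: wstar_openI.
      by move=> f [sf bf [h [[Uh Vh] hf hg]]]; split; split=> //; exists h.
    move=> V [oV Vg]; have [h [hb Vh] hg] := diam_gt g (gV V oV Vg).
    have [f [sf bf hf]] := IH _ hb; exists f; split=> //.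
    by exists h.
  have [A' [UA' AA']] := ultraFilterLemma PA.
  have AW V : wstar_open V -> V g -> A' (W V) by move=> oV Vg; apply: AA'; exists V.
  have A'T := AW _ (wstar_openT G) I.
  have [f sf A'f] : exists2 f, short f & wstar_cvg A' f.
    by apply: alaoglu; apply: filterS A'T => f [].
  have gf : close M (2 * d) g f.
    apply: (close_closed (ltW M0) _ A'f) => V oV Vg.
    by apply: filterS (AW V oV Vg) => f' [_ _ [h [Vh hf' _]]]; exists h.
  have bf : image_iter e b f.
    by apply: (image_iter_closed _ A'f) => //; apply: filterS A'T => f' [].
  exists f; split=> //; split=> // V oV Vf; rewrite ltNge; apply/negP => Vd.
  have A'V : A' [set f' | V (adjoint T f')].
    exact: (wstar_cvg_open _ (@wstar_cvg_adjoint _ _ _ _ T _ _ A'f) oV Vf).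
  have [f' [[sf' bf' [h [_ hf' [v v1 gh]]]] Vf']] := filter_ex (filterI A'T A'V).
  have ff' := close_of f f' v sf sf' v1
    (fun x x1 => @diam_le _ _ _ _ _ (adjoint T f) (adjoint T f') x Vd (conj bf Vf) (conj bf' Vf') x1).
  move: gh; apply/negP; rewrite -leNgt.
  (* If f' and f both had images in a set of small diameter, h would be within 4 d + eps/4 <= eps/2
     of g, as 16 d <= eps. *)
  apply: (@le_trans _ _ (2 * d + (eps / 4 + 2 * d))); last lra.
  apply: le_trans (rdistD _ (of_real M * f (B v)) _) _; apply: lerD; first exact: gf.
  apply: le_trans (rdistD _ (of_real M * f' (B v)) _) _; apply: lerD.
    by rewrite -mulrBr rnormM rnorm_of_real gtr0_norm.
  by rewrite rdistC; exact: hf'.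
- move=> [gS gI].
  (* The added index, with ordinal 0, keeps the family nonempty when [I] is empty. *)
  pose bs' (o : option I) := if o is Some i then bs i else ozero.
  have {}IH o : exists f, [/\ short f, image_iter e (bs' o) f & close M (2 * d) g f].
    case: o => [i|] /=; first exact/IH/gI.
    have [f sf gf] := Sclose g gS; exists f; split=> //; exists f => //.
    exact: short_dual_ball.
  pose W o := [set f | [/\ short f, image_iter e (bs' o) f & close M (2 * d) g f]].
  pose A := filter_from setT W.
  have PA : ProperFilter A.
    apply: filter_from_proper; last by move=> o _; exact: IH.
    apply: filter_from_filter; first by exists None.
    (* Witness sets decrease as the ordinal grows, so totality of the order makes them a filter
       base. *)
    have sub o o' : ole (bs' o) (bs' o') -> W o' `<=` W o `&` W o'.
      move=> oo' f [sf bf gf]; split=> //; split=> //.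
      exact: szlenk_iter_anti oo' _ bf.
    move=> o o' _ _; have [/sub h|/olt_le/sub h] := ole_lt_total (bs' o) (bs' o').
      by exists o'.
    by exists o => //; rewrite setIC.
  have [A' [UA' AA']] := ultraFilterLemma PA.
  have AW o : A' (W o) by apply: AA'; exists o.
  have [f sf A'f] : exists2 f, short f & wstar_cvg A' f.
    by apply: alaoglu; apply: filterS (AW None) => f [].
  exists f; split=> //; last first.
    apply: (close_closed (ltW M0) _ A'f) => V oV Vg.
    by apply: filterS (AW None) => f' [_ _ gf']; exists g.
  split=> [|i]; first by exists f => //; exact: short_dual_ball.
  by apply: (image_iter_closed _ A'f) => //; apply: filterS (AW (Some i)) => f' [].
Qed.

End perturbation.

Lemma olt_irrefl (a : ord) : ~ olt a a.
Proof. by elim/(well_founded_ind olt_wf): a => a IH aa; exact: (IH a aa). Qed.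

(** * The Szlenk index of the interpolation space *)

Section main.
Context {R : realType} {k : scalar_kind}.
Local Notation K := (scalars R k).
Context {E F : completeNormedModType K} (T : operator E F) (a : ord).
Local Notation p := (interp_seminorms T).
Local Notation G := (c0_space p).

(** The estimate by the n-th seminorm is applied to f - f', of norm at most 2, with n such that 2^-n
    2 <= e. *)
Lemma c0_incl_estimate (e : R) : 0 < e -> exists2 C : R, 0 < C &
  forall (f f' : dual F) c, short f -> short f' ->
  (forall x, rnorm x <= 1 -> rnorm (f (T x) - f' (T x)) <= c) ->
  forall v : G, rnorm v <= 1 -> rnorm (f (c0_incl p v) - f' (c0_incl p v)) <= C * c + e.
Proof.
move=> e0.
have [n hn] : exists n : nat, 2 / e <= 2 ^+ n.
  exists (Num.bound (2 / e)); apply: le_trans (ltW (archi_boundP _)) _.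
    by rewrite divr_ge0 // ltW.
  by rewrite -natrX ler_nat ltnW // ltn_expl.
exists (2 ^+ n); first by rewrite exprn_gt0.
move=> f f' c sf sf' ff' v v1.
have c0 : 0 <= c.
  by have := ff' 0; rewrite rnorm0 => /(_ ler01); apply: le_trans; exact: rnorm_ge0.
have lin : linear (fun x => f x - f' x : K^o).
  by move=> s x y; rewrite (linearP f) (linearP f') opprD addrACA scalerBr.
have le2 x : rnorm (f x - f' x : K^o) <= 2 * rnorm x.
  by apply: le_trans (rnormD _ _) _; rewrite rnormN; have := sf x; have := sf' x; lra.
pose D := mk_operator lin le2.
have DT x : rnorm (D (T x)) <= c * rnorm x.
  exact: (unit_ball_le (f := comp_op D T)).
have := functional_le_interp n c0 (ler0n _ 2) DT le2 (c0_val v).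
move=> /le_trans; apply.
have pv1 : interp T n (c0_val v) <= 1.
  by apply: le_trans v1; rewrite rnorm_c0; exact: (le_c0_norm v n).
have n0 : 0 < 2 ^+ n :> R by rewrite exprn_gt0.
rewrite -[leRHS]mulr1; apply: ler_pM pv1.
- by rewrite addr_ge0 // mulr_ge0 // ?invr_ge0 ltW.
- exact: (seminorm_ge0 p).
- by rewrite lerD2l ler_pdivrMl // -ler_pdivrMr.
Qed.

Hypothesis Ta : class_le (Sz_op T) (omega_pow a).

(** Empty for negative [r], which is how the iteration terminates. *)
Definition rball (r : R) : set (dual G) :=
  [set h | forall v : G, rnorm v <= 1 -> rnorm (h v) <= r].

(** A survivor outside the smaller ball lies in a slice close to a multiple of B^* B_{F^*}; by
    perturbation some point of T^* B_{F^*} would then survive omega^a derivations, against the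
    hypothesis on T. *)
Lemma szlenk_iter_rball (eps r : R) : 0 < eps -> r <= 1 ->
  szlenk_iter eps (rball r) (omega_pow a) `<=` rball (r - eps / 16).
Proof.
move=> eps0 r1 g ga v v1; rewrite leNgt; apply/negP => gv.
have gr := szlenk_iter_sub ga.
have r0 : 0 <= r by have := gr 0; rewrite rnorm0 => /(_ ler01); apply: le_trans; exact: rnorm_ge0.
have /asboolP/(_ 4^-1)[//|N hN] := c0P v.
have [M M0 hM] := local_functionals v1 hN.
pose V := [set h : dual G | r - eps / 16 < rnorm (h v)].
(* The depth d = eps / 16 of the slice is the largest allowed by 16 d <= eps. *)
have [|h [hr hv]|e e0 he] := @szlenk_perturb _ _ _ _ _ T (c0_incl p)
   c0_incl_estimate (rball r `&` V) eps M (eps / 16) eps0 M0.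
- lra.
- apply: hM hv; first by rewrite r0.
  exact: unit_ball_le.
have [f [sf bf _]] := he _ _ (szlenk_iter_local (wstar_open_gt v _) gv ga).
apply: (@olt_irrefl (omega_pow a)); apply: Ta.
by exists e => //; exists (adjoint T f).
Qed.

Lemma Sz_interp : class_le (@Sz_space R k G) (omega_pow (osucc a)).
Proof.
move=> b [eps eps0 [g gb]].
have [ab|//] := ole_lt_total (omega_pow (osucc a)) b.
have {gb}ga := szlenk_iter_anti ab gb.
have step n : szlenk_iter eps (@dual_ball R k G) (omul (omega_pow a) (iter n osucc ozero))
    `<=` rball (1 - n%:R * (eps / 16)).
  elim: n => [|n IH] h /=.
    by move=> /dual_norm_le hb; rewrite mul0r subr0.
  move=> /szlenk_iter_oadd /(szlenk_iter_mono IH) /szlenk_iter_rball.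
  rewrite -[n.+1%:R]natr1 mulrDl mul1r opprD addrA; apply=> //.
  by rewrite lerBlDr lerDl mulr_ge0 // divr_ge0 // ltW.
(* omega^(a+1) unfolds to the supremum of the omega^a n, so g survives each of these stages. *)
have gn n : rball (1 - n%:R * (eps / 16)) g by apply: step; case: ga => _ /(_ n).
exfalso.
(* For n > 16 / eps the radius is negative, which is already absurd at the vector 0. *)
have := gn (Num.bound (16 / eps)) 0; rewrite rnorm0 => /(_ ler01).
have /archi_boundP : 0 <= 16 / eps by rewrite divr_ge0 // ltW.
rewrite ltr_pdivrMr // => h.
have := rnorm_ge0 (g 0); lra.
Qed.

End main.

Lemma SZ_factorization (R : realType) (k : scalar_kind) (a : ord)
    (E F : completeNormedModType (scalars R k)) (T : operator E F) :
  class_le (Sz_op T) (omega_pow a) ->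
  exists G : completeNormedModType (scalars R k),
    class_le (Sz_space G) (omega_pow (osucc a)) /\
    exists (A : operator E G) (B : operator G F), T = comp_op B A.
Proof.
move=> Ta; exists (c0_space (interp_seminorms T)); split; first exact: Sz_interp.
exists (interp_in_op T), (c0_incl (interp_seminorms T)).
exact: operator_ext.
Qed.

(** The factorization property is phrased through the identity operator of the intermediate
    space. *)
Lemma Sz_op_id (R : realType) (k : scalar_kind) (G : completeNormedModType (scalars R k)) :
  Sz_op (id_op G) = Sz_space G.
Proof.
rewrite /Sz_op /Sz_space; congr Sz.
have idE (f : dual G) : adjoint (id_op G) f = f by exact: operator_ext.
by apply/seteqP; split=> [_ [f fb <-]|f fb]; [rewrite idE|exists f].
Qed.

Theorem theorem4p1 (R : realType) (k : scalar_kind) (alpha : ord) :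
  has_factorization_property (@SZ R k alpha) (@SZ R k (osucc alpha)) /\
  forall (E F : completeNormedModType (scalars R k)) (T : operator E F),
    class_le (Sz_op T) (omega_pow alpha) ->
    exists G : completeNormedModType (scalars R k),
      class_le (Sz_space G) (omega_pow (osucc alpha)) /\
      exists (A : operator E G) (B : operator G F), T = comp_op B A.
Proof.
split=> E F T Ta; last exact: SZ_factorization.
have [G [GS AB]] := SZ_factorization Ta.
by exists G; split=> //; rewrite /SZ Sz_op_id.
Qed.
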